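(* Let $\beta\ge 0$ and $c\in(0,1)$, and let $\{\mathcal{G}_n\}_{n\ge 1}$ be the directed preferential attachment graph sequence $\operatorname{DPA}(1,\beta)$. The (scale-free) PageRank $R_1(n)$, with damping factor $c$, of the root $v_1$ in $\mathcal{G}_n$ satisfies $$ n^{-(1+(1+\beta)c)/(2+\beta)}\, R_1(n) \xrightarrow{a.s.} W \quad \text{as } n\to\infty, $$ for some positive, almost surely finite random variable $W$.
   Context: **The model $\operatorname{DPA}(1,\beta)$.** $\mathcal{G}_1$ has one vertex $v_1$ (the root) and no edges. $\mathcal{G}_2$ has two vertices $v_1,v_2$ and one edge directed from $v_2$ to $v_1$. For $n\ge 3$, $\mathcal{G}_n$ is obtained from $\mathcal{G}_{n-1}$ by adding a vertex $v_n$ with one outbound edge, which, conditionally on $\mathcal{G}_{n-1}$, is attached to $v_i$ ($1\le i\le n-1$) with probability $$\frac{D_i(n-1)+\beta}{\sum_{j=1}^{n-1}(D_j(n-1)+\beta)},$$ where $D_i(n-1)$ is the total degree (in-degree plus out-degree) of $v_i$ in $\mathcal{G}_{n-1}$. Thus $\mathcal{G}_n$ is a tree with edges directed towards the root. **PageRank.** The scale-free PageRank of $v_i$ in $\mathcal{G}_n$ with damping factor $c$ is $$R_i(n)=(1-c)\left(1+\sum_{k=1}^\infty c^k\,\mathcal{P}^{(n)}_{k,i}\right),\quad i=1,\dots,n,$$ where $\mathcal{P}^{(n)}_{k,i}$ is the number of directed paths of length $k$ in $\mathcal{G}_n$ ending at $v_i$. *)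

(* Defs.v *)
From HB Require Import structures.
From mathcomp Require Import all_boot all_order all_algebra.
From mathcomp Require Import all_classical all_reals all_analysis.

Set Implicit Arguments.
Unset Strict Implicit.
Unset Printing Implicit Defensive.

Import Order.TTheory GRing.Theory Num.Theory.
Import numFieldNormedType.Exports.

Local Open Scope ring_scope.

(* The vertex v_i (i = 1, ..., n) is the ordinal of value i - 1, and the pair
   (x, y) stands for the edge directed from x to y.  In DPA(1, beta) every
   vertex has at most one outbound edge, so no multiplicities are needed. *)
Definition digraph (n : nat) : finType := {set 'I_n * 'I_n}.

Section Digraph.
Variables (n : nat) (g : digraph n).

Definition edge : rel 'I_n := fun x y => (x, y) \in g.

Definition indeg (i : 'I_n) : nat := #|[set j | edge j i]|.
Definition outdeg (i : 'I_n) : nat := #|[set j | edge i j]|.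
Definition degree (i : 'I_n) : nat := (indeg i + outdeg i)%N.

(* A path of length k is given by its starting vertex and its k further
   vertices.  Repetitions are not excluded, but they cannot occur in a tree. *)
Definition npaths (k : nat) (i : 'I_n) : nat :=
  #|[set p : 'I_n * k.-tuple 'I_n |
      path edge p.1 p.2 && (last p.1 p.2 == i)]|.

Definition attach (i : 'I_n) : digraph n.+1 :=
  (ord_max, widen_ord (leqnSn n) i)
    |: [set (widen_ord (leqnSn n) e.1, widen_ord (leqnSn n) e.2) | e in g].

End Digraph.

(* In an acyclic graph npaths g k i = 0 for k >= n, so the partial sums are
   eventually constant and the limit exists. *)
Definition pagerank (R : realType) (c : R) (n : nat) (g : digraph n)
    (i : 'I_n) : R :=
  (1 - c) * (1 + limn (fun m => \sum_(1 <= k < m) c ^+ k * (npaths g k i)%:R)).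

Definition attach_prob (R : realType) (beta : R) (n : nat) (g : digraph n)
    (i : 'I_n) : R :=
  ((degree g i)%:R + beta) / \sum_(j < n) ((degree g j)%:R + beta).

(* Elementary conditional probability P(A | B); meaningful when P B > 0. *)
Definition cond_prob (R : realType) (d : measure_display)
    (T : measurableType d) (P : probability T R) (A B : set T) : R :=
  fine (P (A `&` B)%classic) / fine (P B).

Local Open Scope classical_set_scope.

(* G n is the random graph on n vertices; G 0, the empty graph, is a dummy.
   G n takes finitely many values, so conditioning on it amounts to
   conditioning on each event G n = g of positive probability. *)
Record is_DPA1 (R : realType) (d : measure_display) (T : measurableType d)
    (P : probability T R) (beta : R) (G : forall n, T -> digraph n) : Prop :=
  IsDPA1 {
    DPA1_measurable : forall n (g : digraph n),
      measurable [set w | G n w = g];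
    DPA1_one : forall w, G 1%N w = finset.set0;
    DPA1_two : forall w, G 2%N w = [set (ord_max, ord0)]%SET;
    DPA1_step : forall n w, (2 <= n)%N ->
      exists i : 'I_n, G n.+1 w = attach (G n w) i;
    DPA1_cond : forall n (g : digraph n) (i : 'I_n), (2 <= n)%N ->
      (0 < P [set w | G n w = g])%E ->
      cond_prob P [set w | G n.+1 w = attach g i] [set w | G n w = g]
      = attach_prob beta g i
  }.

(* Main.v *)
Require Import Defs.
From mathcomp Require Import all_boot all_order all_algebra.
From mathcomp Require Import all_classical all_reals all_analysis.
From mathcomp Require Import measurable_realfun.
From mathcomp Require Import ring lra.

Set Implicit Arguments.
Unset Strict Implicit.
Unset Printing Implicit Defensive.

Import Order.TTheory GRing.Theory Num.Theory.
Import numFieldNormedType.Exports.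

Local Open Scope classical_set_scope.
Local Open Scope ring_scope.

(** Write depth x for the distance from a vertex x to the root and n + 1 for
    the number of vertices.  In a tree directed towards the root each vertex
    x starts exactly one path to the root, so the PageRank of the root is
    (1 - c) S with S the sum of c ^ depth x ([pagerank_root]).  A new vertex
    attached to i adds c ^ (depth i + 1) to S.  Summing degrees along edges
    shows that the conditional mean of this increment is an affine function of
    S ([sum_attach_depth]); measured from its fixed point, the quantity
    M = S - (1 + c) / (1 + (1 + beta) c) satisfies
      E [M_(n+1) | G] = (1 + r_n) M_n,   r_n = alpha / (n + delta),
    where alpha is the exponent of the theorem and delta = beta / (2 + beta).
    With A_n the product of the factors 1 + r_k, the ratio M_n / A_n is
    therefore a martingale, and A_n n ^ (- alpha) is nondecreasing and bounded
    ([growth_powR_cvg]).  What remains is the almost sure convergence of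
    M_n / A_n to a positive limit ([root_excess_growth]).

    Convergence.  Increments of M are at most c, so the variance of one
    martingale step is at most a multiple of r_n / A_(n+1), which telescopes as
    1 / A_n - 1 / A_(n+1).  Hence E (M_m / A_m - M_n / A_n) ^ 2 is O(1 / A_n)
    uniformly in m >= n ([integral_sq_dist]).  Along the times (k + 1) ^ p with
    p alpha > 4 this is O(k ^ -4), which makes the subsequence almost surely of
    bounded variation.  Between two such times M is nondecreasing while the
    ratio of the values of A tends to 1, so the whole sequence converges
    ([cvg_ratio_subseq]).

    Positivity.  For Z = M - c > 0 and an increment 0 < x <= c,
    1 / (Z + x) <= 1 / Z - x / (Z (Z + c)) = 1 / Z - x / (Z M), whose
    conditional mean is exactly (1 - r_n) / Z.  Since (1 + r_n) (1 - r_n) <= 1,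
    E (A_n / Z_n) stays bounded ([integral_inv_bounded]).  By the Fatou lemma
    A_n / Z_n is almost surely bounded along some subsequence, which keeps the
    limit of M_n / A_n away from 0.

    Every G_n takes finitely many values, so all expectations are finite sums
    ([fin_mean]) and the Markov property is a recursion between them
    ([fin_mean_step]). *)

(** * Trees directed towards the root *)

(** Together the clauses force a tree directed towards [ord0]: the depth drops
    along edges, and every other vertex has exactly one outgoing edge.  The
    depth is a function on [nat], not on ordinals, so that attaching a vertex
    extends it without casts. *)
Record is_depth (n : nat) (g : digraph n.+1) (d : nat -> nat) : Prop := IsDepth {
  depth_root : d 0%N = 0%N;
  depth_edge : forall x y : 'I_n.+1, edge g x y -> d x = (d y).+1;
  depth_parent : forall x : 'I_n.+1, x != ord0 ->
    exists y, forall z, edge g x z = (z == y)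
}.

(** The index [n] stands for the vertices 0, ..., n, so the new vertex has
    number [n.+1]. *)
Definition attach_depth (n : nat) (d : nat -> nat) (i : nat) : nat -> nat :=
  fun k => if k == n.+1 then (d i).+1 else d k.

Lemma ord_maxVwiden (n : nat) (x : 'I_n.+1) :
  x = ord_max \/ exists y : 'I_n, x = widen_ord (leqnSn n) y.
Proof.
case: (unliftP ord_max x) => [y ->|->]; [right|by left].
by exists y; apply: val_inj; rewrite /= /bump leqNgt ltn_ord add0n.
Qed.

Lemma widen_ord_inj (n : nat) : injective (widen_ord (leqnSn n)).
Proof. by move=> x y [] /val_inj. Qed.

Lemma widen_neq_max (n : nat) (y : 'I_n) : (widen_ord (leqnSn n) y == ord_max) = false.
Proof. by apply/eqP => /(congr1 val) /= e; have := ltn_ord y; rewrite e ltnn. Qed.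

Lemma edge_attach_old (n : nat) (g : digraph n) (i x y : 'I_n) :
  edge (attach g i) (widen_ord (leqnSn n) x) (widen_ord (leqnSn n) y) = edge g x y.
Proof.
rewrite /edge /attach finset.in_setU1 xpair_eqE widen_neq_max /=.
apply/imsetP/idP => [[[u v] uv [/= /val_inj -> /val_inj ->]]//|xy].
by exists (x, y).
Qed.

Lemma edge_attach_new (n : nat) (g : digraph n) (i : 'I_n) (y : 'I_n.+1) :
  edge (attach g i) ord_max y = (y == widen_ord (leqnSn n) i).
Proof.
rewrite /edge /attach finset.in_setU1 xpair_eqE eqxx /=; apply/orb_idr.
move=> /imsetP[[u v] _ [+ _]].
by move=> /= e; have := ltn_ord u; rewrite -e ltnn.
Qed.

Lemma edge_attach_max (n : nat) (g : digraph n) (i : 'I_n) (x : 'I_n.+1) :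
  edge (attach g i) x ord_max = false.
Proof.
rewrite /edge /attach finset.in_setU1 xpair_eqE [ord_max == _]eq_sym widen_neq_max andbF /=.
apply/negP => /imsetP[[u v] _ [_ +]].
by move=> /= e; have := ltn_ord v; rewrite -e ltnn.
Qed.

(** Recovers the past of the attachment chain from its present. *)
Definition detach (n : nat) (g : digraph n.+1) : digraph n :=
  [set e | (widen_ord (leqnSn n) e.1, widen_ord (leqnSn n) e.2) \in g]%SET.

Lemma attachK (n : nat) (i : 'I_n) : cancel (fun g : digraph n => attach g i) (@detach n).
Proof.
move=> g; apply/setP => -[x y]; rewrite inE /=.
exact: edge_attach_old.
Qed.

Lemma attach_inj_vertex (n : nat) (g : digraph n) : injective (attach g).
Proof.
move=> i j /(congr1 (fun h => edge h ord_max (widen_ord (leqnSn n) i))).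
by rewrite !edge_attach_new eqxx => /esym/eqP/widen_ord_inj.
Qed.

Lemma is_depth_two : @is_depth 1 [set (ord_max, ord0)]%SET id.
Proof.
split=> // [x y|x x0].
  by rewrite /edge finset.in_set1 xpair_eqE => /andP[/eqP-> /eqP->].
exists ord0 => z; rewrite /edge finset.in_set1 xpair_eqE.
suff -> : x = ord_max by rewrite eqxx.
apply: val_inj => /=; case: x x0 => -[|[|]]//.
Qed.

Lemma is_depth_attach (n : nat) (g : digraph n.+1) (d : nat -> nat) (i : 'I_n.+1) :
  is_depth g d -> is_depth (attach g i) (attach_depth n d i).
Proof.
move=> [d0 de dp].
have dw (x : 'I_n.+1) : attach_depth n d i (widen_ord (leqnSn n.+1) x) = d x.
  by rewrite /attach_depth /= (ltn_eqF (ltn_ord x)).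
have dm : attach_depth n d i (@ord_max n.+1) = (d i).+1 by rewrite /attach_depth eqxx.
split=> // [x y|x x0].
  have [->|[x' ->]] := ord_maxVwiden x.
    by rewrite edge_attach_new => /eqP->; rewrite dw dm.
  have [->|[y' ->]] := ord_maxVwiden y; first by rewrite edge_attach_max.
  by rewrite edge_attach_old !dw => /de.
have [->|[x' xE]] := ord_maxVwiden x.
  by exists (widen_ord (leqnSn n.+1) i) => z; rewrite edge_attach_new.
have [|y yP] := dp x'.
  by apply: contra x0 => /eqP x'0; rewrite xE x'0; apply/eqP/val_inj.
exists (widen_ord (leqnSn n.+1) y) => z; rewrite xE.
have [->|[z' ->]] := ord_maxVwiden z.
  by rewrite edge_attach_max eq_sym widen_neq_max.
by rewrite edge_attach_old yP (inj_eq (@widen_ord_inj _)).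
Qed.

(** Following the unique outgoing edges from [x] reaches the root after [d x]
    steps, and the walk cannot be continued from there. *)
Lemma card_paths_to_root (n : nat) (g : digraph n.+1) (d : nat -> nat) (k : nat)
    (x : 'I_n.+1) :
  is_depth g d ->
  #|[set p : k.-tuple 'I_n.+1 | path (edge g) x p && (last x p == ord0)]%SET|
  = (d x == k).
Proof.
move=> [d0 de dp]; elim: k x => [|k IHk] x.
  have xd : (x == ord0) = (d x == 0%N).
    apply/eqP/eqP => [-> //|dx]; apply/eqP/negPn/negP => /dp[y yP].
    by have := de x y; rewrite yP eqxx dx => /(_ isT).
  rewrite -xd; case: eqP => x0.
    apply/eqP/cards1P; exists [tuple]; apply/setP => p; rewrite !inE tuple0 /= x0.
    by rewrite !eqxx.
  apply/eqP; rewrite cards_eq0; apply/eqP/setP => p; rewrite !inE tuple0 /=.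
  by apply/negbTE/eqP.
have [->|/[dup] xn0 /dp[y yP]] := eqVneq x ord0.
  rewrite d0 /=; apply/eqP; rewrite cards_eq0; apply/eqP/setP => p; rewrite !inE.
  case/tupleP: p => y p /=; apply/negbTE; rewrite -andbA; apply/negP => /andP[/de].
  by rewrite d0.
have -> : d x = (d y).+1 by apply: de; rewrite yP.
rewrite eqSS -IHk.
have -> : [set p : k.+1.-tuple 'I_n.+1 | path (edge g) x p && (last x p == ord0)]%SET
  = ((fun p : k.-tuple 'I_n.+1 => [tuple of y :: p]) @:
      [set p : k.-tuple 'I_n.+1 | path (edge g) y p && (last y p == ord0)])%SET.
  apply/setP => p; apply/idP/imsetP.
    case/tupleP: p => z p; rewrite inE /= yP => /andP[/andP[/eqP-> pp] lp].
    by exists p; rewrite ?inE ?pp//; apply: val_inj.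
  by move=> [q]; rewrite inE => /andP[qp ql] ->; rewrite inE /= yP eqxx qp ql.
rewrite card_imset// => p q /(congr1 val) /= [] pq; exact: val_inj.
Qed.

Lemma npaths_root (n : nat) (g : digraph n.+1) (d : nat -> nat) (k : nat) :
  is_depth g d ->
  npaths g k ord0 = (\sum_(x < n.+1) (d x == k))%N.
Proof.
move=> gd; rewrite /npaths -sum1_card.
under eq_bigl do rewrite inE.
rewrite -(pair_big_dep xpredT (fun x (p : k.-tuple 'I_n.+1) =>
  path (edge g) x p && (last x p == ord0)) (fun _ _ => 1%N)) /=.
apply: eq_bigr => x _; rewrite -(card_paths_to_root k x gd) -sum1_card.
by apply: eq_bigl => p; rewrite inE.
Qed.

Lemma pagerank_root (R : realType) (c : R) (n : nat) (g : digraph n.+1) (d : nat -> nat) :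
  is_depth g d ->
  pagerank c g ord0 = (1 - c) * \sum_(x < n.+1) c ^+ d x.
Proof.
move=> gd; rewrite /pagerank; congr (_ * _).
have dx0 (x : 'I_n) : (0 < d (lift ord0 x))%N.
  case: (gd) => d0 de dp; have [|y yP] := dp (lift ord0 x); first by [].
  by rewrite (de _ y)// yP.
have [N dN] : exists N, forall x : 'I_n.+1, (d x < N)%N.
  by exists (\max_(x < n.+1) d x).+1 => x; rewrite ltnS (leq_bigmax x).
rewrite big_ord_recl [d _](depth_root gd)// expr0; congr (_ + _).
apply/cvg_lim => //; apply/cvgrPdist_lt => e e0.
(* beyond the maximal depth N - 1 the partial sums are constant *)
near=> m.
have Nm : (N <= m)%N by near: m; exists N.
rewrite (_ : _ - _ = 0) ?normr0//; apply/eqP; rewrite subr_eq0; apply/eqP.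
under [RHS]eq_bigr do rewrite (npaths_root _ gd) natr_sum big_distrr/=.
rewrite exchange_big /= big_ord_recl /= [X in X + _]big_nat.
rewrite [X in X + _]big1 ?add0r; last first.
  by move=> k /andP[k0 _]; rewrite [d _](depth_root gd)// eq_sym (gtn_eqF k0) mulr0.
apply: eq_bigr => x _.
rewrite (bigD1_seq (d (lift ord0 x))) ?iota_uniq //=; last first.
    rewrite mem_index_iota [X in X && _]dx0; exact: leq_trans (dN (lift ord0 x)) Nm.
rewrite eqxx mulr1 big1 ?addr0// => k /negbTE; rewrite eq_sym => ->.
by rewrite mulr0.
Unshelve. all: end_near.
Qed.

(** * Mean of the attachment rule *)

Section AttachmentMean.
Variables (R : realType) (beta c : R) (n : nat) (g : digraph n.+1) (d : nat -> nat).
Hypothesis gd : is_depth g d.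

Lemma indegE i : indeg g i = (\sum_j edge g j i)%N.
Proof.
rewrite /indeg -sum1_card big_mkcond; apply: eq_bigr => j _; rewrite inE.
by case: (edge _ _ _).
Qed.

Lemma outdegE i : outdeg g i = (\sum_j edge g i j)%N.
Proof.
rewrite /outdeg -sum1_card big_mkcond; apply: eq_bigr => j _; rewrite inE.
by case: (edge _ _ _).
Qed.

Lemma outdeg_depth i : outdeg g i = (i != ord0).
Proof.
case: eqP => [->|/eqP/(depth_parent gd)[y yP]] /=.
  rewrite outdegE big1// => j _; apply/eqP; rewrite eqb0; apply/negP.
  by move/(depth_edge gd); rewrite [d _](depth_root gd).
rewrite outdegE (bigD1 y)//= yP eqxx big1// => j /negbTE.
by rewrite yP => ->.
Qed.

Lemma sum_outdeg (f : 'I_n.+1 -> R) :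
  \sum_i (outdeg g i)%:R * f i = \sum_(i < n) f (lift ord0 i).
Proof.
rewrite big_ord_recl outdeg_depth eqxx mul0r add0r.
by apply: eq_bigr => i _; rewrite outdeg_depth mul1r.
Qed.

Lemma sum_indeg (f : 'I_n.+1 -> R) :
  \sum_i (indeg g i)%:R * f i = \sum_i \sum_j (edge g i j)%:R * f j.
Proof.
rewrite exchange_big; apply: eq_bigr => i _.
by rewrite indegE natr_sum big_distrl.
Qed.

Lemma sum_attach_weight :
  \sum_(i < n.+1) ((degree g i)%:R + beta) = (2 + beta) * n%:R + beta.
Proof.
under eq_bigr do rewrite natrD.
rewrite !big_split /= sumr_const card_ord.
under eq_bigr do rewrite -[(indeg g _)%:R]mulr1.
under [X in _ + X + _]eq_bigr do rewrite -[(outdeg g _)%:R]mulr1.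
rewrite sum_outdeg sum_indeg.
under eq_bigr do rewrite -mulr_suml -natr_sum -outdegE.
by rewrite sum_outdeg sumr_const card_ord -mulr_natr -natr1; ring.
Qed.

(** An edge into i comes from a vertex of depth d i + 1, so the in-degree part
    of the sum, like the out-degree part up to a factor c, is the sum of c ^ d
    over the non-root vertices. *)
Lemma sum_attach_depth :
  \sum_(i < n.+1) ((degree g i)%:R + beta) * c ^+ (d i).+1
  = (1 + (1 + beta) * c) * \sum_(i < n.+1) c ^+ d i - (1 + c).
Proof.
under eq_bigr do rewrite natrD !mulrDl.
rewrite !big_split /= sum_outdeg sum_indeg.
have -> : \sum_(i < n.+1) \sum_(j < n.+1) (edge g i j)%:R * c ^+ (d j).+1
  = \sum_(i < n) c ^+ d (lift ord0 i).
  rewrite -(sum_outdeg (fun i => c ^+ d i)); apply: eq_bigr => i _.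
  rewrite outdegE natr_sum big_distrl; apply: eq_bigr => j _ /=.
  by case: (boolP (edge g i j)) => [/(depth_edge gd)->|_]; rewrite ?mul0r.
rewrite [X in _ + X](_ : _ = beta * c * \sum_(i < n.+1) c ^+ d i); last first.
  by rewrite big_distrr; apply: eq_bigr => i _; rewrite exprS mulrA.
under [X in _ + X + _]eq_bigr do rewrite exprS.
by rewrite -big_distrr /= big_ord_recl [d _](depth_root gd) expr0; ring.
Qed.

End AttachmentMean.

(** * Growth of the normalising product *)

Section GrowthRate.
Variable R : realType.
Implicit Types (x y r : R).

(** Young inequality for (1 + y) ^ r and 1 with exponents 1 / r and 1 / (1 - r). *)
Lemma powR_le_bernoulli r y : 0 < r -> r < 1 -> 0 <= y ->
  (1 + y) `^ r <= 1 + r * y.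
Proof.
move=> r0 r1 y0.
have y1 : 0 <= 1 + y by lra.
have q0 : 0 < 1 - r by lra.
have := @conjugate_powR R ((1 + y) `^ r) 1 r^-1 (1 - r)^-1 (powR_ge0 _ _) ler01.
rewrite !invr_gt0 !invrK r0 q0 => /(_ isT isT).
rewrite powR1 -powRrM mulfV ?gt_eqF// powRr1// mulr1 => /(_ _)/le_trans; apply; lra.
Qed.

Lemma powR_ge_bernoulli r x : 0 <= r -> 0 < x ->
  1 + r / (x + 1) <= ((x + 1) / x) `^ r.
Proof.
move=> r0 x0; have x1 : 0 < x + 1 by lra.
rewrite /powR gt_eqF ?divr_gt0//.
apply: le_trans (expR_ge1Dx _); rewrite lerD2l; apply: ler_wpM2l => //.
rewrite -[leRHS]opprK -lnV ?posrE ?divr_gt0// invf_div lerNr.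
have -> : x / (x + 1) = 1 + (- (x + 1)^-1) by field; rewrite gt_eqF.
by apply: le_ln1Dx; rewrite ltrN2 invf_lt1//; lra.
Qed.

Definition growth (alpha delta : R) (n : nat) : R :=
  \prod_(1 <= k < n) (1 + alpha / (k%:R + delta)).

Section Growth.
Variables alpha delta : R.
Hypotheses (alpha_gt0 : 0 < alpha) (alpha_lt1 : alpha < 1).
Hypotheses (delta_ge0 : 0 <= delta) (delta_lt1 : delta < 1).
Local Notation A := (growth alpha delta).

Lemma growth_rate_gt0 n : (0 < n)%N -> 0 < alpha / (n%:R + delta).
Proof.
by move=> n0; rewrite divr_gt0// ltr_wpDr// ltr0n.
Qed.

Lemma growth1 : A 1 = 1. Proof. by rewrite /growth big_geq. Qed.

Lemma growthS n : (0 < n)%N -> A n.+1 = A n * (1 + alpha / (n%:R + delta)).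
Proof. by move=> n0; rewrite /growth big_nat_recr. Qed.

Lemma growth_gt0 n : 0 < A n.
Proof.
rewrite /growth big_nat; apply: prodr_gt0 => k /andP[k1 _].
by rewrite addr_gt0// growth_rate_gt0.
Qed.

Lemma growth_le m n : (0 < m)%N -> (m <= n)%N -> A m <= A n.
Proof.
move=> m0; elim: n => [|n IHn]; first by rewrite leqn0 => /eqP->.
rewrite leq_eqVlt => /predU1P[->//|mn]; apply: le_trans (IHn mn) _.
have n0 : (0 < n)%N by exact: leq_trans m0 mn.
rewrite growthS//; apply: ler_peMr; first exact/ltW/growth_gt0.
by rewrite lerDl; exact/ltW/growth_rate_gt0.
Qed.

(** Each factor 1 + alpha / (k + delta) is at most 1 + 1 / k, and the latter
    telescope. *)
Lemma growth_le_ratio m n : (0 < m)%N -> (m <= n)%N -> A n <= A m * (n%:R / m%:R).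
Proof.
move=> m0; have m0' : (0 : R) < m%:R by rewrite ltr0n.
elim: n => [|n IHn]; first by rewrite leqn0 => /eqP m00; rewrite m00 in m0.
rewrite leq_eqVlt => /predU1P[<-|mn]; first by rewrite divff ?gt_eqF// mulr1.
have n0 : (0 < n)%N by exact: leq_trans m0 mn.
have n0' : (0 : R) < n%:R by rewrite ltr0n.
rewrite growthS//; apply: (@le_trans _ _ (A m * (n%:R / m%:R) * (1 + n%:R^-1))).
  apply: ler_pM; [exact/ltW/growth_gt0| |exact: IHn|].
    by rewrite ltW// addr_gt0// growth_rate_gt0.
  rewrite lerD2l ler_pdivrMr; last by rewrite ltr_wpDr.
  rewrite mulrDr mulVf ?gt_eqF//; apply: le_trans (ltW alpha_lt1) _.
  by rewrite lerDl mulr_ge0// invr_ge0 ltW.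
rewrite -mulrA ler_pM2l ?growth_gt0// -natr1 le_eqVlt; apply/orP; left; apply/eqP.
by field; rewrite !gt_eqF.
Qed.

(** Here delta <= 1 is what makes alpha / (n + delta) dominate the increment
    alpha / (n + 1) of the Bernoulli inequality. *)
Lemma growth_powR_ndecr n : (0 < n)%N ->
  A n * n.+1%:R `^ (- alpha) <= A n.+1 * n.+2%:R `^ (- alpha).
Proof.
move=> n0; have n1 : (0 : R) < n.+1%:R by rewrite ltr0n.
have n2 : (0 : R) < n.+2%:R by rewrite ltr0n.
rewrite !powRN growthS// -mulrA ler_pM2l ?growth_gt0//.
rewrite ler_pdivlMr ?powR_gt0// mulrC ler_pdivrMr ?powR_gt0//.
have -> : n.+2%:R = n.+1%:R * (1 + n.+1%:R^-1) :> R.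
  by rewrite mulrDr mulr1 divff ?gt_eqF// natr1.
have n1V : 0 <= 1 + n.+1%:R^-1 :> R by rewrite addr_ge0// invr_ge0 ltW.
rewrite (powRM _ (ltW n1) n1V) mulrC ler_pM2r ?powR_gt0//.
apply: le_trans (powR_le_bernoulli alpha_gt0 alpha_lt1 _) _; first by rewrite invr_ge0 ltW.
rewrite lerD2l ler_pM2l// lef_pV2 ?posrE//; last by rewrite ltr_wpDr// ltr0n.
by rewrite -natr1 lerD2l ltW.
Qed.

(** The product is compared with (n + delta - 1) ^ alpha: with x = n + delta - 1
    the factor is 1 + alpha / (x + 1) <= ((x + 1) / x) ^ alpha.  The
    comparison starts at n = 2, where x is at least 1. *)
Lemma growth_powR_bounded : exists K, forall n, (0 < n)%N -> A n * n.+1%:R `^ (- alpha) <= K.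
Proof.
have x0 k : 0 < k.+1%:R + delta by rewrite ltr_wpDr// ltr0n.
have B k : A k.+2 <= A 2 * (k.+1%:R + delta) `^ alpha.
  elim: k => [|k IHk].
    apply: ler_peMr; first exact/ltW/growth_gt0.
    rewrite -[leLHS](powRr0 (1 + delta)).
    by apply: ler_powR; rewrite ?lerDl// ltW.
  rewrite growthS//.
  apply: le_trans (ler_wpM2r _ IHk) _; first by rewrite ltW// addr_gt0// growth_rate_gt0.
  rewrite -mulrA ler_pM2l ?growth_gt0//.
  have -> : k.+2%:R + delta =
      (k.+1%:R + delta) * (((k.+1%:R + delta) + 1) / (k.+1%:R + delta)).
    by rewrite mulrCA mulfV ?gt_eqF// mulr1 -[k.+2%:R]natr1; ring.
  have x1 : 0 <= (k.+1%:R + delta + 1) / (k.+1%:R + delta).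
    by rewrite divr_ge0 ?addr_ge0// ltW.
  rewrite (powRM _ (ltW (x0 k)) x1) ler_pM2l ?powR_gt0//.
  apply: le_trans (powR_ge_bernoulli (ltW alpha_gt0) (x0 k)).
  rewrite lerD2l ler_pM2l// le_eqVlt; apply/orP; left; apply/eqP; congr (_^-1).
  have x0k := x0 k; rewrite mulrCA mulfV ?gt_eqF// mulr1; ring.
exists (A 2) => -[//|[|n]] _.
  rewrite growth1 mul1r (@le_trans _ _ 1)//.
    by rewrite -[leRHS](powRr0 2%:R) ler_powR ?ler1n// lerNl oppr0 ltW.
  by rewrite -[leLHS]growth1 growth_le.
rewrite powRN ler_pdivrMr ?powR_gt0//; apply: le_trans (B n) _.
rewrite ler_pM2l ?growth_gt0// ge0_ler_powR ?nnegrE ?ltW//.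
by rewrite -(natr1 n.+2) -(natr1 n.+1); have := ltW delta_lt1; lra.
Qed.

Lemma growth_powR_cvg : exists2 L : R, 0 < L & A n * n.+1%:R `^ (- alpha) @[n --> \oo] --> L.
Proof.
have [K KP] := growth_powR_bounded.
pose u n := A n.+1 * n.+2%:R `^ (- alpha).
have ndu : nondecreasing_seq u.
  by apply/nondecreasing_seqP => n; exact: growth_powR_ndecr.
have cu : cvgn u.
  by apply: nondecreasing_is_cvgn => //; exists K => _ [n _ <-]; exact: KP.
exists (limn u); last by rewrite -cvg_shiftS.
apply: lt_le_trans (nondecreasing_cvgn_le ndu cu 0%N).
by rewrite mulr_gt0 ?growth_gt0 ?powR_gt0.
Qed.

Lemma growth_ge_powR n : (0 < n)%N -> n%:R `^ alpha / 2 <= A n.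
Proof.
move=> n0.
have B k : A 1 * 2%:R `^ (- alpha) <= A k.+1 * k.+2%:R `^ (- alpha).
  elim: k => // k /le_trans; apply; exact: growth_powR_ndecr.
have := B n.-1; rewrite prednK// growth1 mul1r powRN => Bn.
apply: (@le_trans _ _ (n.+1%:R `^ alpha / 2)).
  by rewrite ler_pM2r// ge0_ler_powR ?nnegrE ?ler_nat// ltW.
rewrite mulrC -ler_pdivlMr ?powR_gt0// -powRN; apply: le_trans Bn.
rewrite lef_pV2 ?posrE ?powR_gt0//; apply: le_trans (ler_powR _ (ltW alpha_lt1)) _.
  by rewrite ler1n.
by rewrite powRr1.
Qed.

End Growth.

End GrowthRate.

(** * Convergence criteria for real sequences *)

Section ConvergenceCriteria.
Variable R : realType.
Implicit Types (x b B : R).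

Lemma subseq_bracket (N : nat -> nat) n : (forall k, (k <= N k)%N) -> (N 0%N <= n)%N ->
  exists k, (N k <= n < N k.+1)%N.
Proof.
move=> Nk N0n; have ex : exists k, (n < N k)%N by exists n.+1; exact: Nk.
case: (ex_minnP ex) => -[|k] nk kmin; first by move: nk; rewrite ltnNge N0n.
exists k; rewrite nk andbT leqNgt; apply/negP => /kmin.
by rewrite ltnn.
Qed.

(** Between two consecutive times [N k <= n < N k.+1] monotonicity traps
    M n / A n between M (N k) / A (N k.+1) and M (N k.+1) / A (N k), and both
    differ from the values along [N] by a factor tending to 1. *)
Lemma cvg_ratio_subseq (M A : nat -> R) (N : nat -> nat) (x : R) :
  (forall k, (0 < N k)%N) -> (forall k, (k <= N k)%N) ->
  (forall m n, (0 < m)%N -> (m <= n)%N -> M m <= M n) ->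
  (forall m n, (0 < m)%N -> (m <= n)%N -> A m <= A n) ->
  (forall n, (0 < n)%N -> 0 < A n) ->
  (forall n, (0 < n)%N -> 0 <= M n) ->
  A (N k.+1) / A (N k) @[k --> \oo] --> (1 : R) ->
  M (N k) / A (N k) @[k --> \oo] --> x ->
  M n / A n @[n --> \oo] --> x.
Proof.
move=> N0 Nk Mnd And A0 M0 cA cX.
have up : M (N k.+1) / A (N k) @[k --> \oo] --> x.
  have -> : (fun k => M (N k.+1) / A (N k)) =
      (fun k => M (N k.+1) / A (N k.+1) * (A (N k.+1) / A (N k))).
    by apply/funext => k; rewrite mulrA divfK ?gt_eqF ?A0.
  rewrite -[x]mulr1; apply: cvgM => //.
  by rewrite (cvg_shiftS (fun k => M (N k) / A (N k))).
have lo : M (N k) / A (N k.+1) @[k --> \oo] --> x.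
  have -> : (fun k => M (N k) / A (N k.+1)) =
      (fun k => M (N k) / A (N k) * (A (N k.+1) / A (N k))^-1).
    by apply/funext => k; rewrite invf_div mulrA divfK ?gt_eqF ?A0.
  rewrite (_ : x = x * 1^-1); last by rewrite invr1 mulr1.
  apply: cvgM => //.
  by apply: cvgV => //; exact: oner_neq0.
apply/cvgrPdist_lt => e e0.
move/cvgrPdist_lt : up => /(_ e e0)[K1 _ K1P].
move/cvgrPdist_lt : lo => /(_ e e0)[K2 _ K2P].
pose K := maxn K1 K2.
exists (\max_(k < K.+1) N k) => // n /= Kn.
have NKn k : (k <= K)%N -> (N k <= n)%N.
  by rewrite -ltnS => kK; apply: leq_trans Kn; exact: (leq_bigmax (Ordinal kK)).
have [k /andP[kn nk]] := subseq_bracket Nk (NKn 0%N isT).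
have Kk : (K <= k)%N.
  by rewrite leqNgt; apply/negP => /NKn; rewrite leqNgt nk.
have n0 : (0 < n)%N by exact: leq_trans (N0 k) kn.
have V m n' : (0 < m)%N -> (m <= n')%N -> (A n')^-1 <= (A m)^-1.
  move=> m0 mn; rewrite lef_pV2 ?posrE ?A0//; [exact: And|exact: leq_trans mn].
have V0 m : (0 < m)%N -> 0 <= (A m)^-1 by move=> m0; rewrite invr_ge0 ltW ?A0.
have h1 : M n / A n <= M (N k.+1) / A (N k).
  by apply: ler_pM; [exact: M0|exact: V0|exact/Mnd/ltnW|exact: V].
have h2 : M (N k) / A (N k.+1) <= M n / A n.
  by apply: ler_pM; [exact: M0|exact: V0|exact: Mnd|exact/V/ltnW].
have := K1P k (leq_trans (leq_maxl _ _) Kk).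
have := K2P k (leq_trans (leq_maxr _ _) Kk).
rewrite /= !ltr_distlC => /andP[? ?] /andP[? ?].
by apply/andP; split; [exact: lt_le_trans h2|exact: le_lt_trans h1 _].
Qed.

(** The partial sums are nondecreasing, so a bound along infinitely many of them
    is a bound on all.  This weak form is what [ae_frequently_bounded] gives. *)
Lemma cvg_bounded_variation (u : nat -> R) (B : R) :
  (forall N, exists2 n, (N <= n)%N & \sum_(0 <= k < n) `|u k.+1 - u k| <= B) ->
  cvgn u.
Proof.
move=> uB.
have nd : nondecreasing_seq [normed series (fun k => u k.+1 - u k)].
  by apply: nondecreasing_series => k _ _; exact: normr_ge0.
have : cvgn [normed series (fun k => u k.+1 - u k)].
  apply: nondecreasing_is_cvgn => //; exists B => _ [N _ <-].
  by have [n Nn] := uB N; apply: le_trans; exact: nd.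
move/normed_cvg => c1.
have -> : u = (fun n => u 0%N + series (fun k => u k.+1 - u k) n).
  by apply/funext => n; rewrite [LHS]eq_sum_telescope.
by apply: is_cvgD => //; exact: is_cvg_cst.
Qed.

Lemma cvg_gt0_of_frequently (u : nat -> R) (x b : R) : 0 < b ->
  (forall N, exists2 n, (N <= n)%N & b <= u n) -> u @ \oo --> x -> 0 < x.
Proof.
move=> b0 ub ux; apply: lt_le_trans b0 _; rewrite leNgt; apply/negP => xb.
have := cvgr_lt _ ux _ xb => -[N _ NP].
have [n Nn] := ub N; rewrite leNgt => /negP; apply; exact: NP.
Qed.

Lemma powS_ratio_cvg (p : nat) :
  (k.+2 ^ p)%:R / (k.+1 ^ p)%:R @[k --> \oo] --> (1 : R).
Proof.
have -> : (fun k => (k.+2 ^ p)%:R / (k.+1 ^ p)%:R) = (fun k => (1 + k.+1%:R^-1 : R) ^+ p).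
  apply/funext => k; rewrite !natrX -expr_div_n; congr (_ ^+ _).
  have : k.+1%:R != 0 :> R by rewrite pnatr_eq0.
  by rewrite -[k.+2%:R]natr1; move: k.+1%:R => y y0; field.
suff h : (1 + k.+1%:R^-1 : R) @[k --> \oo] --> (1 : R).
  have := @continuous_cvg _ _ _ _ _ _ (fun x : R => x ^+ p) _ (@exprn_continuous _ p _) h.
  by rewrite /= expr1n; apply.
have := cvgD (@cvg_cst _ (1 : R) _ \oo _) (@cvg_harmonic R).
by rewrite addr0; apply.
Qed.

Lemma sum_inv_sq_le (n : nat) : \sum_(0 <= k < n) (k.+1%:R ^+ 2)^-1 <= 2 :> R.
Proof.
(* the sharper bound 2 - 1 / n is what induction can prove *)
have H m : \sum_(0 <= k < m.+1) (k.+1%:R ^+ 2)^-1 <= 2 - m.+1%:R^-1 :> R.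
  elim: m => [|m IHm]; first by rewrite big_nat1 expr1n invr1; lra.
  rewrite big_nat_recr//=; apply: le_trans (lerD IHm (lexx _)) _.
  have m0 : (0 : R) < m.+1%:R by rewrite ltr0n.
  rewrite -[m.+2%:R]natr1 -subr_ge0.
  rewrite (_ : _ - _ = (m.+1%:R * (m.+1%:R + 1) ^+ 2)^-1).
    by rewrite invr_ge0 mulr_ge0 ?sqr_ge0 ?ltW.
  by field; rewrite !gt_eqF// addr_gt0.
case: n => [|n]; first by rewrite big_geq.
by apply: le_trans (H n) _; rewrite gerBl invr_ge0.
Qed.

End ConvergenceCriteria.

(** * Finite-valued random variables *)

Section FiniteExpectation.
Context {R : realType} {d : measure_display} {T : measurableType d}.
Variable P : probability T R.

(** The expectation of F (X w), kept as a finite sum so that the recursions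
    along the chain are plain algebra; [integral_fin_comp] is the link to the
    integral. *)
Definition fin_mean (I : finType) (X : T -> I) (F : I -> R) : R :=
  \sum_i fine (P [set w | X w = i]) * F i.

Lemma fin_mean_ext_le (I : finType) (X : T -> I) (F F' : I -> R) :
  (forall w, F (X w) <= F' (X w)) -> fin_mean X F <= fin_mean X F'.
Proof.
move=> FF'; apply: ler_sum => i _.
have [[w Xw]|nX] := pselect (exists w, X w = i).
  by rewrite -Xw; apply: ler_wpM2l; [exact: fine_ge0|exact: FF'].
rewrite (_ : [set w | X w = i] = set0) ?measure0 ?mul0r//.
by apply/seteqP; split => // w Xw; apply: nX; exists w.
Qed.

Lemma fin_mean_ext (I : finType) (X : T -> I) (F F' : I -> R) :
  (forall w, F (X w) = F' (X w)) -> fin_mean X F = fin_mean X F'.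
Proof. by move=> FF'; apply/eqP; rewrite eq_le !fin_mean_ext_le// => w; rewrite FF'. Qed.

Lemma fin_meanZ (I : finType) (X : T -> I) (F : I -> R) (k : R) :
  fin_mean X (fun i => k * F i) = k * fin_mean X F.
Proof. by rewrite /fin_mean big_distrr; apply: eq_bigr => i _; rewrite mulrCA. Qed.

Lemma fin_meanD (I : finType) (X : T -> I) (F F' : I -> R) :
  fin_mean X (fun i => F i + F' i) = fin_mean X F + fin_mean X F'.
Proof. by rewrite /fin_mean -big_split; apply: eq_bigr => i _; rewrite mulrDr. Qed.

Lemma fin_mean_ge0 (I : finType) (X : T -> I) (F : I -> R) :
  (forall w, 0 <= F (X w)) -> 0 <= fin_mean X F.
Proof.
move=> F0; apply: le_trans (fin_mean_ext_le (F := fun=> 0) F0).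
by rewrite /fin_mean big1// => i _; rewrite mulr0.
Qed.

Section Integral.
Variables (I : finType) (X : T -> I).
Hypothesis mX : forall i, measurable [set w | X w = i].

Lemma fin_comp_indic (F : I -> R) w : F (X w) = \sum_i F i * \1_[set w | X w = i] w.
Proof.
rewrite (bigD1 (X w))//= indicE mem_set// mulr1 big1 ?addr0// => i iX.
rewrite indicE memNset ?mulr0//= => Xw; by rewrite Xw eqxx in iX.
Qed.

Lemma measurable_fin_comp (F : I -> R) : measurable_fun setT (fun w => F (X w)).
Proof.
rewrite (_ : (fun w => F (X w)) = (fun w => \sum_i F i * \1_[set w | X w = i] w)).
  by apply: measurable_sum => i; exact: measurable_funM.
by apply/funext => w; rewrite fin_comp_indic.
Qed.

Lemma integral_fin_comp (F : I -> R) : (forall w, 0 <= F (X w)) ->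
  (\int[P]_w (F (X w))%:E = (fin_mean X F)%:E)%E.
Proof.
move=> F0.
(* F matters on the range of X alone, so it may be replaced by its norm *)
rewrite (@fin_mean_ext _ X F (fun i => `|F i|)); last by move=> w; rewrite ger0_norm.
under eq_integral do rewrite -[F _]ger0_norm// (fin_comp_indic (fun i => `|F i|)) -sumEFin.
rewrite ge0_integral_sum//=; last first.
  by move=> i; apply/measurable_EFinP; exact: measurable_funM.
rewrite /fin_mean -sumEFin; apply: eq_bigr => i _.
under eq_integral do rewrite EFinM.
rewrite ge0_integralZl_EFin//=; last first.
  by apply/measurable_EFinP; exact: measurable_indic.
rewrite integral_indic// setIT EFinM fineK ?fin_num_measure//.
by rewrite muleC.
Qed.

Lemma fin_mean_cst (k : R) : fin_mean X (fun=> k) = k.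
Proof.
suff -> : fin_mean X (fun=> k) = k * fin_mean X (fun=> 1).
  have := @integral_fin_comp (fun=> 1) (fun=> ler01).
  rewrite integral_cst//= (_ : (1 * _)%E = 1%E); last first.
    by rewrite mul1e; exact: probability_setT.
  by case=> <-; rewrite mulr1.
by rewrite -fin_meanZ; apply: fin_mean_ext => w; rewrite mulr1.
Qed.

End Integral.

(** The Fatou lemma: the lower limit of [f n] has a finite integral, hence is
    almost everywhere finite. *)
Lemma ae_frequently_bounded (f : nat -> T -> R) (C : R) :
  (forall n, measurable_fun setT (f n)) -> (forall n w, 0 <= f n w) ->
  (forall n, (\int[P]_w (f n w)%:E <= C%:E)%E) ->
  {ae P, forall w, exists B, forall N, exists2 n, (N <= n)%N & f n w <= B}.
Proof.
move=> mf f0 fC.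
pose F n w := (f n w)%:E.
have mF n : measurable_fun setT (F n) by exact/measurable_EFinP.
have F0 n w : setT w -> (0 <= F n w)%E by rewrite lee_fin.
pose g w := limn_einf (F^~ w).
have mg : measurable_fun setT g.
  rewrite /g /limn_einf; apply: measurableT_comp => //.
  by apply: measurable_fun_limn_esup => n; apply: measurableT_comp.
have g0 w : (0 <= g w)%E.
  rewrite /g limn_einf_lim; apply: lime_ge; first exact: is_cvg_einfs.
  apply: nearW => n; apply/ereal_infP => _ [m /= _ <-]; exact: F0.
have ig : (\int[P]_w g w <= C%:E)%E.
  apply: le_trans (fatou _ measurableT mF F0) _.
  rewrite limn_einf_lim; apply: lime_le; first exact: is_cvg_einfs.
  apply: nearW => n; apply: le_trans (fC n).
  by apply: ge_ereal_inf; exists (\int[P]_w F n w)%E => //; exists n => /=.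
have gint : P.-integrable setT g.
  apply/integrableP; split => //.
  under eq_integral do rewrite gee0_abs//.
  exact: le_lt_trans ig (ltry _).
have := integrable_ae measurableT gint; apply: filterS => w /(_ I) gfin.
exists (fine (g w) + 1) => N.
have : (einfs (F^~ w) N < (fine (g w) + 1)%:E)%E.
  apply: (@le_lt_trans _ _ (g w)).
    rewrite /g limn_einf_lim (cvg_lim _ (cvg_einfs_sup (u := _)))//.
    by apply: ereal_sup_ubound; exists N.
  by rewrite -[ltLHS](fineK gfin) lte_fin ltrDl.
move=> /ereal_inf_lt[_ [n /= Nn <-]]; rewrite lte_fin => /ltW fB.
by exists n.
Qed.

End FiniteExpectation.

(** * The attachment chain *)

Section Chain.
Context {R : realType} {d : measure_display} {T : measurableType d}.
Variables (P : probability T R) (beta : R) (G : forall n, T -> digraph n).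
Hypothesis GP : is_DPA1 P beta G.

Lemma attach_event_sub n (g : digraph n) (i : 'I_n) : (2 <= n)%N ->
  [set w | G n.+1 w = attach g i] `<=` [set w | G n w = g].
Proof.
move=> n2 w /= Gw; have [j Gj] := DPA1_step GP w n2.
by rewrite -(attachK j (G n w)) -Gj Gw (attachK i g).
Qed.

Lemma prob_attach n (g : digraph n) (i : 'I_n) : (2 <= n)%N ->
  fine (P [set w | G n.+1 w = attach g i]) =
  fine (P [set w | G n w = g]) * attach_prob beta g i.
Proof.
move=> n2; have sub := attach_event_sub (g := g) (i := i) n2.
have mg := DPA1_measurable GP g.
have mi := DPA1_measurable GP (attach g i).
have := measure_ge0 P [set w | G n w = g]; rewrite le_eqVlt => /predU1P[P0|Ppos].
  suff -> : P [set w | G n.+1 w = attach g i] = 0%E by rewrite -P0 mul0r.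
  by apply/eqP; rewrite eq_le measure_ge0 andbT P0 le_measure ?inE.
rewrite -(DPA1_cond GP i n2 Ppos) /cond_prob setIidl// mulrC divfK//.
rewrite gt_eqF//; apply: fine_gt0; rewrite Ppos /=.
exact: le_lt_trans (probability_le1 _ mg) (ltry _).
Qed.

(** The Markov property.  Since [attach] is injective in both arguments, a
    reachable graph on [n.+1] vertices determines its predecessor and the
    vertex chosen, so the sum over graphs is a sum over such pairs. *)
Lemma fin_mean_step n (F : digraph n.+1 -> R) : (2 <= n)%N ->
  fin_mean P (G n.+1) F =
  fin_mean P (G n) (fun g => \sum_i attach_prob beta g i * F (attach g i)).
Proof.
move=> n2; pose p h := fine (P [set w | G n.+1 w = h]).
(* unreachable h contribute 0 to both sides *)
have pE h : p h * F h =
    \sum_(gi : digraph n * 'I_n) (h == attach gi.1 gi.2)%:R * (p h * F h).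
  have [[[g i] /= hE]|nh] := pselect (exists gi : digraph n * 'I_n, h = attach gi.1 gi.2).
    rewrite (bigD1 (g, i))//= hE eqxx mul1r big1 ?addr0// => -[g' i'] /=.
    apply: contraNeq; rewrite mulf_eq0 negb_or pnatr_eq0 eqb0 negbK => /andP[/eqP + _].
    move=> e; have gE : g = g' by rewrite -(attachK i g) e (attachK i' g').
    by move: e; rewrite gE => /attach_inj_vertex ->.
  rewrite /p (_ : [set w | _] = set0) ?measure0 ?mul0r ?big1// => [[g i] _|].
    by rewrite mulr0.
  apply/seteqP; split => // w /= hE; apply: nh.
  by have [i Gi] := DPA1_step GP w n2; exists (G n w, i); rewrite -hE.
rewrite {1}/fin_mean.
under eq_bigr do rewrite -[X in X * _]/(p _) pE.
rewrite exchange_big /= /fin_mean.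
under [RHS]eq_bigr do rewrite big_distrr /=.
rewrite [RHS]pair_big /=; apply: eq_bigr => -[g i] _ /=.
rewrite (bigD1 (attach g i))//= eqxx mul1r big1 ?addr0; last first.
  by move=> h /negbTE ->; rewrite mul0r.
by rewrite /p prob_attach// -mulrA.
Qed.

Lemma exists_depth n w : (0 < n)%N -> exists d, is_depth (G n.+1 w) d.
Proof.
case: n => // n _; elim: n => [|n [dn IHn]].
  by exists id; rewrite (DPA1_two GP); exact: is_depth_two.
have [//|i ->] := DPA1_step GP (n := n.+2) w.
by exists (attach_depth n.+1 dn i); exact: is_depth_attach.
Qed.

Lemma detach_G n w : (2 <= n)%N -> detach (G n.+1 w) = G n w.
Proof. by move=> n2; have [i ->] := DPA1_step GP w n2; exact: attachK. Qed.

End Chain.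

(** * The excess of the root PageRank *)

Section RootPageRank.
Variables (R : realType) (beta c : R).
Hypotheses (beta_ge0 : 0 <= beta) (c_gt0 : 0 < c) (c_lt1 : c < 1).

Definition root_exponent : R := (1 + (1 + beta) * c) / (2 + beta).
Definition root_shift : R := beta / (2 + beta).
Local Notation alpha := root_exponent.
Local Notation delta := root_shift.
Local Notation A := (growth alpha delta).
Local Notation rate n := (alpha / (n%:R + delta)).

(** Fixed point of the mean recursion of the sum of c ^ depth. *)
Definition root_center : R := (1 + c) / (1 + (1 + beta) * c).

(** Indexed so that a graph of index [n] has [n.+1] vertices; the excess is the
    quantity M of the introduction. *)
Definition root_excess (n : nat) (g : digraph n.+1) : R :=
  pagerank c g ord0 / (1 - c) - root_center.

Let denom_gt0 : 0 < 2 + beta. Proof. by rewrite ltr_wpDr. Qed.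

Let numer_gt0 : 0 < 1 + (1 + beta) * c.
Proof. by rewrite addr_gt0// mulr_gt0// ltr_wpDr. Qed.

Lemma root_exponent_gt0 : 0 < alpha. Proof. exact: divr_gt0. Qed.

Lemma root_exponent_lt1 : alpha < 1.
Proof.
rewrite ltr_pdivrMr// mul1r.
have : (1 + beta) * c < 1 + beta by rewrite gtr_pMr// ltr_wpDr.
lra.
Qed.

Lemma root_shift_ge0 : 0 <= delta.
Proof. by rewrite divr_ge0// ltW. Qed.

Lemma root_shift_lt1 : delta < 1.
Proof. by rewrite ltr_pdivrMr// mul1r; lra. Qed.

(** This bound is what makes the excess at least c from two vertices on. *)
Lemma root_center_le1 : root_center <= 1.
Proof.
rewrite ler_pdivrMr// mul1r.
by rewrite lerD2l mulrDl mul1r lerDl mulr_ge0// ltW.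
Qed.

Lemma root_excessE n (g : digraph n.+1) d : is_depth g d ->
  root_excess g = \sum_(x < n.+1) c ^+ d x - root_center.
Proof.
move=> gd; rewrite /root_excess (pagerank_root c gd) mulrC mulKf//.
by rewrite gt_eqF// subr_gt0.
Qed.

Lemma attach_prob_ge0 n (g : digraph n) i : 0 <= attach_prob beta g i.
Proof. by rewrite divr_ge0 ?addr_ge0// sumr_ge0// => j _; rewrite addr_ge0. Qed.

Lemma sum_attach_prob n (g : digraph n.+1) d : (0 < n)%N -> is_depth g d ->
  \sum_i attach_prob beta g i = 1.
Proof.
move=> n0 gd; rewrite /attach_prob -big_distrl /= mulfV//.
rewrite (sum_attach_weight _ gd) gt_eqF// ltr_wpDr// mulr_gt0 ?ltr0n//.
Qed.

Lemma root_excess_attach n (g : digraph n.+1) d i : is_depth g d ->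
  root_excess (attach g i) = root_excess g + c ^+ (d i).+1.
Proof.
move=> gd; rewrite (root_excessE (is_depth_attach i gd)) (root_excessE gd).
rewrite big_ord_recr /= {2}/attach_depth eqxx addrAC; congr (_ - _ + _).
by apply: eq_bigr => j _; rewrite /attach_depth /= (ltn_eqF (ltn_ord j)).
Qed.

Lemma mean_increment n (g : digraph n.+1) d : (0 < n)%N -> is_depth g d ->
  \sum_i attach_prob beta g i * c ^+ (d i).+1 = rate n * root_excess g.
Proof.
move=> n0 gd; under eq_bigr do rewrite /attach_prob mulrAC.
rewrite -big_distrl /= (sum_attach_depth _ _ gd) (sum_attach_weight _ gd).
rewrite (root_excessE gd) /root_exponent /root_shift /root_center.
have n0' : (0 : R) < n%:R by rewrite ltr0n.
field; rewrite !gt_eqF// ltr_wpDr// mulr_gt0//.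
Qed.

Lemma increment_gt0 k : 0 < c ^+ k. Proof. exact: exprn_gt0. Qed.

Lemma increment_le k : c ^+ k.+1 <= c.
Proof. by rewrite exprS ger_pMr// exprn_ile1// ltW. Qed.

(** * Moment bounds *)

Section Moments.
Context {d : measure_display} {T : measurableType d}.
Variables (P : probability T R) (G : forall n, T -> digraph n).
Hypothesis GP : is_DPA1 P beta G.

Local Notation mean n F := (fin_mean P (G n.+1) F).
Local Notation M n w := (root_excess (G n.+1 w)).

Lemma root_excess_lt n w : (0 < n)%N -> M n w < M n.+1 w.
Proof.
move=> n0; have [i ->] := DPA1_step GP (n := n.+1) w n0.
have [dn gd] := exists_depth GP w n0.
by rewrite (root_excess_attach _ gd) ltrDl increment_gt0.
Qed.

Lemma root_excess_le m n w : (0 < m)%N -> (m <= n)%N -> M m w <= M n w.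
Proof.
move=> m0; elim: n => [|n IHn]; first by rewrite leqn0 => /eqP m00; rewrite m00 in m0.
rewrite leq_eqVlt => /predU1P[->//|mn]; apply: le_trans (IHn mn) _.
by apply/ltW/root_excess_lt/(leq_trans m0).
Qed.

Lemma root_excess1 w : M 1 w = 1 + c - root_center.
Proof.
have gd : is_depth (G 2 w) id by rewrite (DPA1_two GP); exact: is_depth_two.
by rewrite (root_excessE gd) !big_ord_recl big_ord0 addr0.
Qed.

Lemma root_excess_ge n w : (0 < n)%N -> c <= M n w.
Proof.
move=> n0; apply: le_trans (root_excess_le (m := 1%N) w isT n0); rewrite root_excess1.
have := root_center_le1; lra.
Qed.

Lemma root_excess_gt n w : (1 < n)%N -> c < M n w.
Proof.
case: n => [//|n] n1; apply: le_lt_trans (root_excess_lt w n1).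
exact: root_excess_ge.
Qed.

(** [fin_mean_step] restricted to the trees that the chain can reach, where a
    depth function is available. *)
Lemma mean_step_le n (F : digraph n.+2 -> R) (F' : digraph n.+1 -> R) :
  (0 < n)%N ->
  (forall w d, is_depth (G n.+1 w) d ->
    \sum_i attach_prob beta (G n.+1 w) i * F (attach (G n.+1 w) i) <= F' (G n.+1 w)) ->
  mean n.+1 F <= mean n F'.
Proof.
move=> n0 FF'; rewrite (fin_mean_step GP)//; apply: fin_mean_ext_le => w.
by have [dn gd] := exists_depth GP w n0; exact: FF' gd.
Qed.

(** The excess of the graph with two vertices. *)
Let M1 : R := 1 + c - root_center.

Let M1_ge0 : 0 <= M1.
Proof. by rewrite subr_ge0 (le_trans root_center_le1)// lerDl ltW. Qed.

Let A_gt0 n : 0 < A n.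
Proof. exact: growth_gt0 root_exponent_gt0 root_shift_ge0 n. Qed.

Let rate_gt0 n : (0 < n)%N -> 0 < rate n.
Proof. exact: growth_rate_gt0 root_exponent_gt0 root_shift_ge0 n. Qed.

Lemma mean_root_excess_le n : (0 < n)%N -> mean n (@root_excess n) <= A n * M1.
Proof.
case: n => // n _; elim: n => [|n IHn].
  rewrite growth1 mul1r -[leRHS](fin_mean_cst P (DPA1_measurable GP (n := 2))).
  by apply: fin_mean_ext_le => w; rewrite root_excess1.
rewrite growthS// mulrAC; apply: le_trans (ler_wpM2r _ IHn); last first.
  by rewrite ltW// addr_gt0// rate_gt0.
rewrite mulrC -fin_meanZ; apply: mean_step_le => // w dn gd.
under eq_bigr do rewrite (root_excess_attach _ gd) mulrDr.
rewrite big_split /= -big_distrl /= (sum_attach_prob _ gd)// (mean_increment _ gd)//.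
by rewrite mulrDl.
Qed.

(** Taking [Y] arbitrary makes the bound iterate: any function of the past of the
    chain is of the form [Y (detach h)].  The last term bounds the variance of
    one step, c M1 r / (A (1 + r) ^ 2), by its telescoping majorant
    c M1 r / (A (1 + r)), where A (1 + r) = A n.+1. *)
Lemma sq_dist_step n (Y : digraph n.+1 -> R) : (0 < n)%N ->
  mean n.+1 (fun h => (root_excess h / A n.+1 - Y (detach h)) ^+ 2)
  <= mean n (fun g => (root_excess g / A n - Y g) ^+ 2)
     + c * M1 * ((A n)^-1 - (A n.+1)^-1).
Proof.
move=> n0; set r := rate n; have r0 : 0 < r by exact: rate_gt0.
have An := A_gt0 n; have AE : A n.+1 = A n * (1 + r) by rewrite growthS.
have r1 : 0 < 1 + r by rewrite addr_gt0.
pose F' (g : digraph n.+1) :=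
  (root_excess g / A n - Y g) ^+ 2 + c * r / A n.+1 ^+ 2 * root_excess g.
apply: (@le_trans _ _ (mean n F')).
  apply: mean_step_le => // w dn gd; set g := G n.+1 w in gd *.
  set D := root_excess g / A n.+1 - Y g.
  (* with A' = A n.+1 and 0 <= x <= c, (D + x / A') ^ 2 <=
     D ^ 2 + x (2 D / A' + c / A' ^ 2) *)
  have step i :
      attach_prob beta g i
        * (root_excess (attach g i) / A n.+1 - Y (detach (attach g i))) ^+ 2
      <= attach_prob beta g i * D ^+ 2
         + attach_prob beta g i * c ^+ (dn i).+1 * (2 * D / A n.+1 + c / A n.+1 ^+ 2).
    rewrite -mulrA -mulrDr; apply: ler_wpM2l; first exact: attach_prob_ge0.
    rewrite (attachK i g) (root_excess_attach _ gd); set x := c ^+ (dn i).+1.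
    rewrite (_ : (root_excess g + x) / A n.+1 - Y g = D + x / A n.+1); last first.
      by rewrite /D; ring.
    rewrite -subr_ge0 (_ : _ - _ = x * (c - x) / A n.+1 ^+ 2); last first.
      by field; rewrite gt_eqF.
    by rewrite divr_ge0 ?sqr_ge0// mulr_ge0 ?subr_ge0 ?increment_le// ltW ?increment_gt0.
  apply: le_trans (ler_sum _ (fun i _ => step i)) _.
  rewrite big_split /= -[X in X + _ <= _]big_distrl -[X in _ + X <= _]big_distrl /=
     (sum_attach_prob _ gd)// (mean_increment _ gd)//.
  rewrite mul1r /F' -/r -subr_ge0 (_ : _ - _ = (r * root_excess g / A n.+1) ^+ 2) ?sqr_ge0//.
  by rewrite /D AE; field; rewrite !gt_eqF.
rewrite fin_meanD fin_meanZ lerD2l.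
apply: le_trans (ler_wpM2l _ (mean_root_excess_le n0)) _.
  by rewrite divr_ge0 ?sqr_ge0// mulr_ge0// ltW.
rewrite -subr_ge0 (_ : _ - _ = c * M1 * r ^+ 2 / (A n * (1 + r) ^+ 2)).
  apply: divr_ge0; last by rewrite mulr_ge0 ?sqr_ge0// ltW.
  by rewrite mulr_ge0 ?sqr_ge0// mulr_ge0 ?M1_ge0// ltW.
by rewrite AE; field; rewrite !gt_eqF.
Qed.

(** Recovers the graph on [n.+1] vertices from a later one, by [iter_detach_G]. *)
Fixpoint iter_detach (n k : nat) : digraph (k + n).+1 -> digraph n.+1 :=
  match k return digraph (k + n).+1 -> digraph n.+1 with
  | 0%N => id
  | k'.+1 => fun h => @iter_detach n k' (detach h)
  end.

Lemma iter_detach_G n k w : (0 < n)%N -> iter_detach (G (k + n).+1 w) = G n.+1 w.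
Proof.
move=> n0; elim: k => //= k IHk.
by rewrite (detach_G GP)// ltnS addn_gt0 n0 orbT.
Qed.

(** The bounds of [sq_dist_step] telescope. *)
Lemma sq_dist_le n k : (0 < n)%N ->
  mean (k + n) (fun h => (root_excess h / A (k + n) - root_excess (iter_detach h) / A n) ^+ 2)
  <= c * M1 / A n.
Proof.
move=> n0; apply: (@le_trans _ _ (c * M1 * ((A n)^-1 - (A (k + n))^-1))); last first.
  by rewrite ler_wpM2l ?mulr_ge0// ?(ltW c_gt0)// gerBl invr_ge0 ltW.
elim: k => [|k IHk].
  rewrite subrr mulr0; under eq_fun do rewrite /= subrr expr0n.
  by rewrite (fin_mean_cst P (DPA1_measurable GP (n := n.+1))).
apply: le_trans (sq_dist_step (n := k + n) (fun h => root_excess (iter_detach h) / A n) _) _.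
  by rewrite addn_gt0 n0 orbT.
by apply: le_trans (lerD IHk (lexx _)) _; rewrite -mulrDr addrA subrK.
Qed.

Lemma integral_sq_dist m n : (0 < n)%N -> (n <= m)%N ->
  (\int[P]_w ((M m w / A m - M n w / A n) ^+ 2)%:E <= (c * M1 / A n)%:E)%E.
Proof.
move=> n0 nm; rewrite -(subnK nm); set k := (m - n)%N.
under eq_integral do rewrite -(iter_detach_G k _ n0).
have := integral_fin_comp P (DPA1_measurable GP (n := (k + n).+1))
  (F := fun h => (root_excess h / A (k + n) - root_excess (iter_detach h) / A n) ^+ 2).
by move=> ->; [rewrite lee_fin sq_dist_le|move=> w; rewrite sqr_ge0].
Qed.

(** The shift by c is chosen so that the chord of x |-> 1 / (Z + x) over [0, c]
    has slope - 1 / (Z M); since the mean increment is r M, the mean of the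
    chord is exactly (1 - r) / Z. *)
Lemma mean_inv_step n : (1 < n)%N ->
  mean n.+1 (fun h => (root_excess h - c)^-1)
  <= (1 - rate n) * mean n (fun g => (root_excess g - c)^-1).
Proof.
move=> n1; have n0 : (0 < n)%N by exact: ltnW.
rewrite -fin_meanZ; apply: mean_step_le => // w dn gd; set g := G n.+1 w in gd *.
have := root_excess_gt w n1; rewrite -subr_gt0 -/g => Z0.
have M0 : 0 < root_excess g by rewrite -(subrK c (root_excess g)) addr_gt0.
have step i : attach_prob beta g i * (root_excess (attach g i) - c)^-1
   <= attach_prob beta g i * (root_excess g - c)^-1
     - attach_prob beta g i * c ^+ (dn i).+1 / ((root_excess g - c) * root_excess g).
  rewrite -mulrA -mulrBr; apply: ler_wpM2l; first exact: attach_prob_ge0.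
  rewrite (root_excess_attach _ gd).
  have := increment_gt0 (dn i).+1; have := increment_le (dn i).
  move: (c ^+ _) => x xc x0; have Zx : 0 < root_excess g + x - c by lra.
  rewrite -subr_ge0 (_ : _ - _ = x * (c - x) /
    ((root_excess g - c) * root_excess g * (root_excess g + x - c))).
    apply: divr_ge0; last by rewrite ltW// !mulr_gt0.
    by apply: mulr_ge0; [exact: ltW|rewrite subr_ge0].
  by field; rewrite !gt_eqF.
apply: le_trans (ler_sum _ (fun i _ => step i)) _.
rewrite sumrB -[X in X - _ <= _]big_distrl -[X in _ - X <= _]big_distrl /=.
rewrite (sum_attach_prob _ gd)// (mean_increment _ gd)//.
rewrite le_eqVlt; apply/orP; left; apply/eqP; rewrite -/g; move: (rate n) => r.
by field; rewrite !gt_eqF.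
Qed.

(** Follows from [mean_inv_step] and (1 + r) (1 - r) <= 1. *)
Lemma mean_inv_bounded : exists C, forall n, (1 < n)%N ->
  A n * mean n (fun g => (root_excess g - c)^-1) <= C.
Proof.
exists (A 2 * mean 2 (fun g => (root_excess g - c)^-1)) => -[//|[//|n]] _.
elim: n => // n; apply: le_trans.
set m := fin_mean P (G n.+3) _.
have m0 : 0 <= m.
  by apply: fin_mean_ge0 => w; rewrite invr_ge0 subr_ge0 ltW// root_excess_gt.
have An := A_gt0 n.+2; have r0 := rate_gt0 (n := n.+2) isT.
apply: le_trans (ler_wpM2l (ltW (A_gt0 n.+3)) (mean_inv_step (n := n.+2) isT)) _.
rewrite growthS// -/m mulrA -[leRHS]mul1r mulrA; apply: ler_wpM2r => //.
rewrite mul1r -mulrA ger_pMr//; move: (rate _) r0 => r r0; have := sqr_ge0 r; nra.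
Qed.

Lemma integral_inv_bounded : exists C, forall n, (1 < n)%N ->
  (\int[P]_w (A n / (M n w - c))%:E <= C%:E)%E.
Proof.
have [C CP] := mean_inv_bounded; exists C => n n1.
have := integral_fin_comp P (DPA1_measurable GP (n := n.+1))
  (F := fun h => A n * (root_excess h - c)^-1).
move=> ->; first by rewrite lee_fin fin_meanZ CP.
move=> w; apply: mulr_ge0; first exact: ltW.
by rewrite invr_ge0 subr_ge0 ltW// root_excess_gt.
Qed.

(** * Almost sure growth of the excess *)

Lemma measurable_root_excess n (F : R -> R) :
  measurable_fun setT (fun w => F (M n w)).
Proof.
exact: (measurable_fin_comp (DPA1_measurable GP (n := n.+1))
  (fun h => F (root_excess h))).
Qed.

Let A_ge_quartic p k : 4 / alpha < p%:R -> k.+1%:R ^+ 4 / 2 <= A (k.+1 ^ p)%N.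
Proof.
move=> hp; apply: le_trans (growth_ge_powR root_exponent_gt0 root_exponent_lt1
  root_shift_ge0 root_shift_lt1 _); last by rewrite expn_gt0.
rewrite ler_pM2r ?invr_gt0// -powR_mulrn ?ler0n// natrX -powR_mulrn ?ler0n//.
rewrite -powRrM; apply: ler_powR; first by rewrite ler1n.
by rewrite -ler_pdivrMr ?root_exponent_gt0// ltW.
Qed.

Lemma root_excess_growth :
  {ae P, forall w, exists2 x : R, 0 < x & M n w / A n @[n --> \oo] --> x}.
Proof.
pose p := Num.bound (4 / alpha).
have hp : 4 / alpha < p%:R.
  by apply: archi_boundP; rewrite divr_ge0// ltW// root_exponent_gt0.
have p0 : (0 < p)%N.
  by rewrite -(ltr0n R); apply: le_lt_trans hp; rewrite divr_ge0// ltW// root_exponent_gt0.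
pose N k := (k.+1 ^ p)%N.
have N0 k : (0 < N k)%N by rewrite expn_gt0.
have Nk k : (k <= N k)%N.
  by apply: ltnW; rewrite -[X in (X <= _)%N]expn1 leq_pexp2l.
have NS k : (N k <= N k.+1)%N by rewrite leq_exp2r.
(* squared increments along the subsequence, weighted in f by (k + 1) ^ 2:
   their means are O((k + 1) ^ -4), and |x| <= t + x ^ 2 / t with
   t = (k + 1) ^ -2 turns a bound on the weighted sum into bounded variation *)
pose y k w := (M (N k.+1) w / A (N k.+1) - M (N k) w / A (N k)) ^+ 2.
have y0 k w : 0 <= y k w by exact: sqr_ge0.
have my k : measurable_fun setT (y k).
  apply: measurable_funX; apply: measurable_funB.
    exact: (measurable_root_excess (N k.+1) (fun x => x / A (N k.+1))).
  exact: (measurable_root_excess (N k) (fun x => x / A (N k))).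
pose f n w := \sum_(0 <= k < n) k.+1%:R ^+ 2 * y k w.
have B1 : {ae P, forall w, exists B, forall m, exists2 n, (m <= n)%N & f n w <= B}.
  apply: (ae_frequently_bounded (C := 4 * (c * M1))) => [n|n w|n].
  - by apply: measurable_sum => k; exact: measurable_funM.
  - by apply: sumr_ge0 => k _; rewrite mulr_ge0// sqr_ge0.
  - under eq_integral do rewrite -sumEFin.
    rewrite ge0_integral_sum//=; last 2 first.
    + by move=> k; apply/measurable_EFinP; exact: measurable_funM.
    + by move=> k w _; rewrite lee_fin mulr_ge0// sqr_ge0.
    apply: (@le_trans _ _ (\sum_(0 <= k < n) (2 * (c * M1) * (k.+1%:R ^+ 2)^-1)%:E)%E).
      apply: lee_sum => k _.
      under eq_integral do rewrite EFinM.
      rewrite ge0_integralZl_EFin//=; [|by move=> w _; rewrite lee_fin|exact/measurable_EFinP].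
      apply: le_trans (lee_wpmul2l _ (integral_sq_dist (N0 k) (NS k))) _.
        by rewrite lee_fin sqr_ge0.
      rewrite -EFinM lee_fin.
      have k0 : (0 : R) < k.+1%:R by rewrite ltr0n.
      have q0 : 0 < k.+1%:R ^+ 4 / 2 :> R by rewrite divr_gt0// exprn_gt0.
      have cM0 : 0 <= c * M1 by rewrite mulr_ge0 ?M1_ge0// ltW.
      have -> : 2 * (c * M1) * (k.+1%:R ^+ 2)^-1 =
          k.+1%:R ^+ 2 * (c * M1 / (k.+1%:R ^+ 4 / 2)).
        by field; rewrite gt_eqF.
      rewrite ler_wpM2l ?sqr_ge0// ler_wpM2l// lef_pV2 ?posrE ?A_gt0//.
      exact: A_ge_quartic.
    rewrite sumEFin lee_fin -big_distrr /=.
    have cM0 : 0 <= 2 * (c * M1) by rewrite !mulr_ge0 ?M1_ge0// ltW.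
    apply: le_trans (ler_wpM2l cM0 (sum_inv_sq_le R n)) _.
    by rewrite le_eqVlt; apply/orP; left; apply/eqP; ring.
have [C CP] := integral_inv_bounded.
have B2 : {ae P, forall w, exists B, forall m, exists2 n, (m <= n)%N &
    A n.+2 / (M n.+2 w - c) <= B}.
  apply: (ae_frequently_bounded (C := C)) => [n|n w|n].
  - exact: (measurable_root_excess n.+2 (fun x => A n.+2 / (x - c))).
  - apply: divr_ge0; first exact: ltW.
    by rewrite subr_ge0 ltW// root_excess_gt.
  - exact: CP.
apply: filterS2 B1 B2 => w [b1 H1] [b2 H2].
have cN : cvgn (fun k => M (N k) w / A (N k)).
  apply: (cvg_bounded_variation (B := 2 + b1)) => m.
  have [n mn fn] := H1 m; exists n => //.
  apply: le_trans (lerD (sum_inv_sq_le R n) fn).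
  rewrite /f -big_split /=; apply: ler_sum => k _.
  have k0 : (0 : R) < k.+1%:R by rewrite ltr0n.
  rewrite /y -[X in _ + _ * X]real_normK ?num_real//.
  move: `|_| (normr_ge0 (M (N k.+1) w / A (N k.+1) - M (N k) w / A (N k))) => x x0.
  have := sqr_ge0 (k.+1%:R^-1 - k.+1%:R * x).
  have : k.+1%:R^-1 * k.+1%:R * x = x by rewrite mulVf ?mul1r ?gt_eqF.
  by rewrite -exprVn; move: (k.+1%:R) (k.+1%:R^-1) => q q'; lra.
have cX : M n w / A n @[n --> \oo] --> limn (fun k => M (N k) w / A (N k)).
  apply: (@cvg_ratio_subseq _ (fun n => M n w) A N) => //.
  - by move=> m n; exact: root_excess_le.
  - by move=> m n; exact: growth_le root_exponent_gt0 root_shift_ge0 _ _.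
  - by move=> n n0; exact/ltW/(lt_le_trans c_gt0)/root_excess_ge.
  - apply: (@squeeze_cvgr _ _ _ _ (fun=> 1) (fun k => (k.+2 ^ p)%:R / (k.+1 ^ p)%:R)).
    + apply: nearW => k; rewrite ler_pdivlMr ?A_gt0// mul1r ler_pdivrMr ?A_gt0//.
      by rewrite mulrC growth_le_ratio ?growth_le ?root_exponent_gt0
        ?root_exponent_lt1 ?root_shift_ge0.
    + exact: cvg_cst.
    + exact: powS_ratio_cvg.
exists (limn (fun k => M (N k) w / A (N k))) => //.
have Z0 n : 0 < M n.+2 w - c by rewrite subr_gt0 root_excess_gt.
have b20 : 0 < b2.
  by have [n _] := H2 0%N; apply: lt_le_trans; rewrite divr_gt0.
apply: (cvg_gt0_of_frequently (b := b2^-1)) cX; first by rewrite invr_gt0.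
move=> m; have [n mn Hn] := H2 m; exists n.+2; first by rewrite !leqW.
rewrite ler_pdivlMr ?A_gt0// mulrC ler_pdivrMr//.
move: Hn; rewrite ler_pdivrMr// => /le_trans; apply.
by rewrite mulrC ler_pM2r// gerBl ltW.
Qed.

End Moments.
End RootPageRank.

(** * The theorem *)

Lemma powR_harmonic_cvg0 (R : realType) (alpha : R) : 0 < alpha ->
  n.+1%:R `^ (- alpha) @[n --> \oo] --> (0 : R).
Proof.
move=> alpha0.
have -> : (fun n => n.+1%:R `^ (- alpha)) = (fun n => (harmonic n : R) `^ alpha).
  by apply/funext => n; rewrite /= -[n.+1%:R^-1]powR_inv1 ?ler0n// -powRrM mulN1r.
apply: cvg_comp (powR_cvg0 alpha0) => U U0.
have : \forall n \near \oo, 0 < harmonic n :> R -> U (harmonic n) := @cvg_harmonic R _ U0.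
apply: filterS => n; apply.
by rewrite /= invr_gt0 ltr0n.
Qed.

Theorem theorem3p3 (R : realType) (d : measure_display) (T : measurableType d)
    (P : probability T R) (beta c : R) (G : forall n, T -> digraph n)
    (beta_ge0 : 0 <= beta) (c_gt0 : 0 < c) (c_lt1 : c < 1)
    (G_DPA1 : is_DPA1 P beta G) :
  exists W : {RV P >-> R},
    (forall w, 0 < W w) /\
    {ae P, forall w,
      n.+1%:R `^ (- ((1 + (1 + beta) * c) / (2 + beta)))
        * pagerank c (G n.+1 w) ord0 @[n --> \oo] --> W w}.
Proof.
rewrite -/(root_exponent beta c); set alpha := root_exponent beta c.
set delta := root_shift beta.
have alpha_gt0 : 0 < alpha by exact: root_exponent_gt0.
pose f n w := n.+1%:R `^ (- alpha) * pagerank c (G n.+1 w) ord0.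
have mf n : measurable_fun setT (f n).
  exact: (measurable_fin_comp (DPA1_measurable G_DPA1 (n := n.+1))
    (fun g => n.+1%:R `^ (- alpha) * pagerank c g ord0)).
pose l w := fine (limn_esup (fun n => (f n w)%:E)).
have ml : measurable_fun setT l.
  apply: measurableT_comp => //.
  by apply: measurable_fun_limn_esup => n; exact/measurable_EFinP.
have mW : measurable_fun setT (fun w => if 0 < l w then l w else 1).
  apply: measurable_fun_ifT => //.
  by apply: measurable_fun_ltr.
(* the value 1, which keeps W positive everywhere, is taken on a null set *)
exists (mfun_Sub (mem_set mW)); split => [w|] /=; first by case: ifPn.
have [L L0 AL] := growth_powR_cvg alpha_gt0 (root_exponent_lt1 beta_ge0 c_lt1)
  (root_shift_ge0 beta_ge0) (root_shift_lt1 beta_ge0).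
have := root_excess_growth beta_ge0 c_gt0 c_lt1 G_DPA1.
apply: filterS => w [x x0 Mx].
have fl : f n w @[n --> \oo] --> (1 - c) * (L * x).
  have -> : f ^~ w = (fun n => (1 - c) *
      (growth alpha delta n * n.+1%:R `^ (- alpha)
         * (root_excess beta c (G n.+1 w) / growth alpha delta n)
       + n.+1%:R `^ (- alpha) * root_center beta c)).
    apply/funext => n; rewrite /f /root_excess -/alpha.
    have An : growth alpha delta n != 0.
      by rewrite gt_eqF// growth_gt0// root_shift_ge0.
    have c1 : 1 - c != 0 by rewrite gt_eqF// subr_gt0.
    by field; rewrite An.
  rewrite -[L * x]addr0 -[0](mul0r (root_center beta c)).
  apply: cvgM; first exact: cvg_cst.
  apply: cvgD; first exact: cvgM.
  by apply: cvgM; [exact: powR_harmonic_cvg0|exact: cvg_cst].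
have fl0 : 0 < (1 - c) * (L * x) by rewrite !mulr_gt0// subr_gt0.
suff -> : l w = (1 - c) * (L * x) by rewrite fl0.
have : (f n w)%:E @[n --> \oo] --> ((1 - c) * (L * x))%:E
  by apply/fine_cvgP; split; [exact: nearW|exact: fl].
by rewrite /l => /cvg_limn_einf_sup[_ ->].
Qed.
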